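(* For any finite simple graph $G$, $\alpha(G)=\alpha'(G)$ if and only if $\tau(G)=\mu(G)$.
   Context: For a graph $G$ and $S\subseteq V(G)$, $N(S)=\bigcup_{u\in S}N(u)$. $\alpha(G)$ is the independence number, $\tau(G)$ the vertex covering number (minimum size of a set of vertices meeting every edge), and $\mu(G)$ the matching number (maximum size of a set of pairwise non-incident edges). An independent set $I_c$ is a critical independent set if $|I_c|-|N(I_c)|\ge |J|-|N(J)|$ for every independent set $J$ of $G$; the critical independence number $\alpha'(G)$ is the maximum cardinality of a critical independent set. *)

(* Defs.v *)
From mathcomp Require Import all_boot all_order all_algebra.

Set Implicit Arguments.
Unset Strict Implicit.
Unset Printing Implicit Defensive.

(* A finite simple graph is a finType T of vertices together with an adjacency
   relation e : rel T. Symmetry and irreflexivity of e are not needed by the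
   definitions below and are left as hypotheses of the theorem. *)

Section Graph.
Variables (T : finType) (e : rel T).

Definition neighbors (u : T) : {set T} := [set v | e u v].

Definition neighborhood (S : {set T}) : {set T} :=
  \bigcup_(u in S) neighbors u.

Definition edges : {set {set T}} :=
  [set [set p.1; p.2] | p : T * T & e p.1 p.2].

Definition independent (S : {set T}) : bool :=
  [forall x in S, forall y in S, ~~ e x y].

Definition independence_number : nat :=
  \max_(S : {set T} | independent S) #|S|.

Definition vertex_cover (S : {set T}) : bool :=
  [forall f in edges, f :&: S != set0].

(* The vertex set [set: T] serves as the initial cover of the minimization;
   it is always a vertex cover, as edges are nonempty. *)
Definition covering_number : nat :=
  #|[arg min_(S < [set: T] | vertex_cover S) #|S|]%N|.

Definition matching (M : {set {set T}}) : bool :=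
  (M \subset edges) && trivIset M.

Definition matching_number : nat :=
  \max_(M : {set {set T}} | matching M) #|M|.

(* The difference |S| - |N(S)| may be negative, hence is taken in int. *)
Definition set_excess (S : {set T}) : int :=
  (#|S|%:Z - #|neighborhood S|%:Z)%R.

Definition critical_independent (I : {set T}) : bool :=
  independent I &&
  [forall J : {set T}, independent J ==> (set_excess J <= set_excess I)%R].

Definition critical_independence_number : nat :=
  \max_(I : {set T} | critical_independent I) #|I|.

End Graph.

(* Main.v *)
Require Import Defs.
From mathcomp Require Import all_boot all_order all_algebra.
From mathcomp Require Import zify.

(** Complements of vertex covers are the independent sets, so
    alpha + tau = |V|.  A matching of size mu pairs up 2 mu vertices, and each
    pair contributes to N(J) at least as much as to J; hence
    |J| - |N(J)| <= |V| - 2 mu for every J.  If tau = mu, a maximum independent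
    set reaches this bound, so it is critical.
    Conversely, if a maximum independent set I is critical, then V \ I = N(I),
    and any S in V \ I violating Hall's condition towards I would make
    I \ N(S) of larger excess than I.  Hall's theorem then matches V \ I
    into I, a matching of size tau; and mu <= tau always holds. *)

Set Implicit Arguments.
Unset Strict Implicit.
Unset Printing Implicit Defensive.

(** * Hall's marriage theorem *)

Lemma hall_injection (T U : finType) (u0 : U) (N : T -> {set U}) (A : {set T}) :
    (forall S : {set T}, S \subset A -> #|S| <= #|\bigcup_(x in S) N x|) ->
  exists f : T -> U,
    {in A &, injective f} /\ {in A, forall x, f x \in N x}.
Proof.
have [n] := ubnP #|A|; elim: n N A => // n IHn N A; rewrite ltnS => leAn hallA.
have [->|[x xA]] := set_0Vmem A.
  (* [u0] is the default value that makes a total function available when [A] is empty. *)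
  by exists (fun=> u0); split=> [? ?|?]; rewrite inE.
(* If some nonempty proper [S] is tight, [S] and [A :\: S] are matched separately; otherwise every
   such [S] has a neighbor to spare, and a single pair can be removed. *)
case: (boolP [exists S : {set T}, [&& S != set0, S \proper A &
                #|\bigcup_(x in S) N x| <= #|S|]]) => [/existsP[S] | noTight].
  case/and3P=> S0 SA tight.
  have sSA := proper_sub SA.
  have [||f [injf fN]] := IHn N S.
  - exact: leq_trans (proper_card SA) leAn.
  - by move=> S' /subset_trans/(_ sSA)/hallA.
  pose NS := \bigcup_(x in S) N x.
  have [||g [injg gN]] := IHn (fun x => N x :\: NS) (A :\: S).
  - apply: leq_trans leAn; rewrite cardsD (setIidPr sSA).
    by have := subset_leq_card sSA; move: S0; rewrite -card_gt0; lia.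
  (* Hall's condition for [S' :|: S], minus the at most [#|S|] elements of [NS], leaves [#|S'|]
     elements outside [NS]. *)
  - move=> S' sS'.
    have dis : [disjoint S' & S].
      by move: sS'; rewrite subsetD => /andP[].
    have sU : S' :|: S \subset A.
      by rewrite subUset sSA andbT (subset_trans sS') ?subsetDl.
    have := hallA _ sU; rewrite cardsU (disjoint_setI0 dis) cards0 bigcup_setU.
    have -> : \bigcup_(i in S') (N i :\: NS) = (\bigcup_(i in S') N i) :\: NS.
      apply/setP=> y; rewrite in_setD; apply/bigcupP/andP.
        by case=> i iS'; rewrite in_setD => /andP[-> yi]; split=> //;
           apply/bigcupP; exists i.
      by case=> yN /bigcupP[i iS' yi]; exists i; rewrite // in_setD yN.
    by rewrite cardsU cardsD -/NS; move: tight; rewrite -/NS;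
       have := subset_leq_card (subsetIl (\bigcup_(i in S') N i) NS); lia.
  have fNS y : y \in S -> f y \in NS.
    by move=> yS; apply/bigcupP; exists y => //; apply: fN.
  have gNS y : y \in A -> y \notin S -> (g y \notin NS) && (g y \in N y).
    by move=> yA yS; have := gN y; rewrite !inE yA yS => /(_ isT).
  exists (fun y => if y \in S then f y else g y); split=> [y z yA zA|y yA].
    case: ifP => yS; case: ifP => zS.
    - exact: injf.
    - move=> eqfg; have := fNS y yS.
      by rewrite eqfg; have /andP[/negPf->] := gNS z zA (negbT zS).
    - move=> eqfg; have := fNS z zS.
      by rewrite -eqfg; have /andP[/negPf->] := gNS y yA (negbT yS).
    - by apply: injg; rewrite inE ?yS ?zS.
  by case: ifP => yS; [apply: fN | case/andP: (gNS y yA (negbT yS))].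
have /card_gt0P[u uNx] : 0 < #|N x|.
  by have := hallA [set x]; rewrite sub1set big_set1 cards1 => /(_ xA).
(* Any [u] in [N x] can serve [x]: without tight sets, losing one element preserves Hall's condition
   on [A :\ x]. *)
have [||g [injg gN]] := IHn (fun x => N x :\ u) (A :\ x).
- by move: leAn; rewrite (cardsD1 x A) xA.
- move=> S sS.
  have [->|S0] := eqVneq S set0; first by rewrite cards0.
  have pS : S \proper A by apply: sub_proper_trans sS (properD1 xA).
  have -> : \bigcup_(i in S) (N i :\ u) = (\bigcup_(i in S) N i) :\ u.
    apply/setP=> y; rewrite in_setD1; apply/bigcupP/andP.
      by case=> i iS; rewrite in_setD1 => /andP[-> yi]; split=> //;
         apply/bigcupP; exists i.
    by case=> yu /bigcupP[i iS yi]; exists i; rewrite // in_setD1 yu.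
  have := existsPn noTight S; rewrite S0 pS /= -ltnNge (cardsD1 u).
  by case: (_ \in _); lia.
have gNu y : y \in A -> y != x -> (g y != u) && (g y \in N y).
  by move=> yA yx; have := gN y; rewrite !inE yA yx => /(_ isT).
exists (fun y => if y == x then u else g y); split=> [y z yA zA|y yA].
  case: eqVneq => [->|yx]; case: eqVneq => [->|zx] //.
  - by move=> eqg; have := gNu z zA zx; rewrite -eqg eqxx.
  - by move=> eqg; have := gNu y yA yx; rewrite eqg eqxx.
  - by apply: injg; rewrite !inE ?yx ?zx.
by case: eqVneq => [->|yx] //; case/andP: (gNu y yA yx).
Qed.

(** * Counting along disjoint blocks, and attained maxima *)

Lemma leq_matching_sum (T : finType) (F G : T -> nat) (M : {set {set T}}) :
    trivIset M ->
    {in M, forall m : {set T}, \sum_(x in m) F x <= \sum_(x in m) G x} ->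
  \sum_(x in cover M) F x <= \sum_(x in cover M) G x.
Proof. by move=> tM leFG; rewrite !big_trivIset //; apply: leq_sum. Qed.

(** Turns the size of an intersection into a sum that can be split along the edges of a matching. *)
Lemma sum_mem_card (T : finType) (A B : {set T}) :
  \sum_(x in A) (x \in B : nat) = #|A :&: B|.
Proof.
by rewrite -sum1_card big_mkcond [RHS]big_mkcond; apply: eq_bigr => x _;
   rewrite inE; case: (x \in A); case: (x \in B).
Qed.

Lemma bigmax_attained (I : finType) (P : pred I) (F : I -> nat) i0 :
  P i0 -> exists2 i, P i & F i = \max_(j | P j) F j.
Proof.
move=> Pi0; have pos : 0 < #|P| by apply/card_gt0P; exists i0.
by have [i Pi eqi] := eq_bigmax_cond F pos; exists i; [exact: Pi | exact: esym].
Qed.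

Section Graph.
Variables (T : finType) (e : rel T).

(** * Independence, covering and matching numbers *)

Lemma mem_neighborhood (S : {set T}) y :
  reflect (exists2 x, x \in S & e x y) (y \in neighborhood e S).
Proof.
by apply: (iffP bigcupP) => -[x xS]; rewrite ?inE => exy; exists x; rewrite ?inE.
Qed.

Lemma edgesP (m : {set T}) :
  reflect (exists x y, e x y /\ m = [set x; y]) (m \in edges e).
Proof.
apply: (iffP imsetP) => [[[x y]]|[x [y [exy ->]]]].
  by rewrite inE => exy ->; exists x, y.
by exists (x, y); rewrite ?inE.
Qed.

Lemma independentP (S : {set T}) :
  reflect {in S &, forall x y, ~~ e x y} (independent e S).
Proof.
apply: (iffP forall_inP) => indS x => [y xS yS|xS].
  exact: (forall_inP (indS x xS)).
by apply/forall_inP => y; apply: indS.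
Qed.

Lemma vertex_coverP (S : {set T}) :
  reflect (forall x y, e x y -> (x \in S) || (y \in S)) (vertex_cover e S).
Proof.
apply: (iffP forall_inP) => [covS x y exy|covS m /edgesP[x [y [exy ->]]]].
  have /set0Pn[z] : [set x; y] :&: S != set0.
    by apply: covS; apply/edgesP; exists x, y.
  by rewrite !inE => /andP[/orP[]/eqP-> ->]; rewrite ?orbT.
by apply/set0Pn; case/orP: (covS x y exy) => zS; [exists x | exists y];
   rewrite !inE zS eqxx ?orbT.
Qed.

(** An edge misses [~: S] exactly when both its ends lie in [S]. *)
Lemma vertex_cover_setC (S : {set T}) :
  vertex_cover e (~: S) = independent e S.
Proof.
apply/vertex_coverP/independentP => [covS x y xS yS|indS x y].
  by apply/negP => /covS; rewrite !inE xS yS.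
apply: contraLR; rewrite negb_or !inE !negbK => /andP[].
exact: indS.
Qed.

Lemma independent0 : independent e set0.
Proof. by apply/independentP => x y; rewrite inE. Qed.

Lemma covering_numberP :
  exists2 S, vertex_cover e S & #|S| = covering_number e.
Proof.
rewrite /covering_number; case: arg_minnP => [|S covS _]; last by exists S.
by apply/vertex_coverP => x y _; rewrite inE.
Qed.

Lemma covering_number_le (S : {set T}) :
  vertex_cover e S -> covering_number e <= #|S|.
Proof.
rewrite /covering_number; case: arg_minnP => [|S' _]; last exact.
by apply/vertex_coverP => x y _; rewrite inE.
Qed.

Lemma independence_numberP :
  exists2 I, independent e I & #|I| = independence_number e.
Proof. exact: (bigmax_attained _ independent0). Qed.

Lemma independence_number_ge (I : {set T}) :
  independent e I -> #|I| <= independence_number e.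
Proof. exact: (@leq_bigmax_cond _ (independent e) (fun I => #|I|)). Qed.

Lemma independence_covering_number :
  independence_number e + covering_number e = #|T|.
Proof.
have [I indI eqI] := independence_numberP.
have [S covS eqS] := covering_numberP.
have := @covering_number_le (~: I); rewrite vertex_cover_setC => /(_ indI).
have := @independence_number_ge (~: S).
rewrite -vertex_cover_setC setCK => /(_ covS).
by have := cardsC S; have := cardsC I; lia.
Qed.

Lemma matching_numberP :
  exists2 M, matching e M & #|M| = matching_number e.
Proof.
apply: (@bigmax_attained _ (matching e) _ set0).
by rewrite /matching sub0set; apply/trivIsetP => A B; rewrite inE.
Qed.

Lemma matching_number_ge (M : {set {set T}}) :
  matching e M -> #|M| <= matching_number e.
Proof. exact: (@leq_bigmax_cond _ (matching e) (fun M => #|M|)). Qed.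

Lemma critical_independence_numberP :
  exists2 I, critical_independent e I & #|I| = critical_independence_number e.
Proof.
(* The empty set is independent, so some independent set maximizes the excess; it is critical. *)
have [I indI maxI] := Order.TotalTheory.arg_maxP (set_excess e) independent0.
apply: (@bigmax_attained _ (critical_independent e) _ I).
by rewrite /critical_independent indI; apply/forall_inP => J /maxI.
Qed.

Lemma critical_independence_number_ge (I : {set T}) :
  critical_independent e I -> #|I| <= critical_independence_number e.
Proof. exact: (@leq_bigmax_cond _ (critical_independent e) (fun I => #|I|)). Qed.

Lemma critical_independence_number_le :
  critical_independence_number e <= independence_number e.
Proof. by apply/bigmax_leqP => I /andP[/independence_number_ge]. Qed.

(** * Matchings against covers, neighborhoods and critical sets *)

Hypotheses (e_sym : symmetric e) (e_irr : irreflexive e).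

Lemma edge_neq x y : e x y -> x != y.
Proof. by apply: contraTneq => ->; rewrite e_irr. Qed.

(** The disjoint edges of a matching each contain their own vertex of the cover. *)
Lemma matching_number_le : matching_number e <= covering_number e.
Proof.
have [M /andP[sM tM] <-] := matching_numberP.
have [S covS <-] := covering_numberP.
apply: leq_trans (subset_leq_card (subsetIr (cover M) S)).
rewrite -sum_mem_card big_trivIset // -sum1_card.
apply: leq_sum => m /(subsetP sM) mE.
by rewrite sum_mem_card card_gt0 (forall_inP covS).
Qed.

Lemma matching_cover_card (M : {set {set T}}) :
  matching e M -> #|cover M| = 2 * #|M|.
Proof.
case/andP=> sM /eqP <-; rewrite -sum1_card big_distrr /=.
apply: eq_bigr => m /(subsetP sM)/edgesP[x [y [exy ->]]].
by rewrite cards2 (edge_neq exy).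
Qed.

(** Inside [cover M], [J] is no larger than its neighborhood; outside it, [J] has at most
    [#|T| - 2 * #|M|] elements. *)
Lemma matching_excess_le (M : {set {set T}}) (J : {set T}) :
  matching e M -> #|J| + 2 * #|M| <= #|neighborhood e J| + #|T|.
Proof.
move=> matM; have /andP[sM tM] := matM; rewrite -(matching_cover_card matM).
have : #|cover M :&: J| <= #|cover M :&: neighborhood e J|.
  rewrite -!sum_mem_card; apply: leq_matching_sum => // m.
  move=> /(subsetP sM)/edgesP[x [y [exy ->]]].
  (* [addnC] crosses the ends: one end in [J] puts the other in the neighborhood. *)
  rewrite !(big_setU1, big_set1) ?inE ?(edge_neq exy) //= addnC.
  have memN a b : e a b -> (a \in J) <= (b \in neighborhood e J).
    move=> eab; case aJ: (a \in J) => //.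
    by rewrite lt0b; apply/mem_neighborhood; exists a.
  by rewrite leq_add ?memN // e_sym.
have := subset_leq_card (subsetIr (cover M) (neighborhood e J)).
have := cardsID (cover M) J; rewrite setIC.
have := subset_leq_card (subsetDr J (cover M)).
by have := cardsC (cover M); lia.
Qed.

Lemma independent_neighborhood_disjoint (I : {set T}) :
  independent e I -> neighborhood e I \subset ~: I.
Proof.
move/independentP=> indI; apply/subsetP=> y /mem_neighborhood[x xI exy].
by rewrite inE; apply: contraL exy => yI; apply: indI.
Qed.

(** A vertex outside [I] with no neighbor in [I] could be added to [I]. *)
Lemma maximum_independent_neighborhood (I : {set T}) :
  independent e I -> #|I| = independence_number e -> neighborhood e I = ~: I.
Proof.
move=> indI maxI; apply/eqP; rewrite eqEsubset.
rewrite independent_neighborhood_disjoint //=; apply/subsetP=> y yI.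
apply: contraT => yN; have noE x : x \in I -> ~~ e x y.
  by move=> xI; apply: contra yN => exy; apply/mem_neighborhood; exists x.
have := @independence_number_ge (y |: I).
rewrite cardsU1 -in_setC yI -maxI ltnn; apply; apply/independentP => a b.
rewrite !inE => /predU1P[->|aI] /predU1P[->|bI].
- by rewrite e_irr.
- by rewrite e_sym noE.
- exact: noE.
- by apply: (independentP _ indI).
Qed.

Lemma matching_of_injection (C : {set T}) (f : T -> T) :
    {in C &, injective f} -> {in C, forall x, f x \notin C} ->
    {in C, forall x, e x (f x)} ->
  #|C| <= matching_number e.
Proof.
move=> injf fC ef; pose edge x := [set x; f x].
(* A shared vertex is in [C] for both edges or an image for both, since [f] leaves [C]. *)
have meet : {in C &, forall x y z, z \in edge x -> z \in edge y -> x = y}.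
  move=> x y xC yC z; rewrite !inE => /orP[]/eqP-> /orP[]/eqP //.
  - by move=> xfy; have := fC y yC; rewrite -xfy xC.
  - by move=> fxy; have := fC x xC; rewrite fxy yC.
  - exact: injf.
have inj_edge : {in C &, injective edge}.
  by move=> x y xC yC exy; apply: (meet x y xC yC x); rewrite -?exy !inE eqxx.
rewrite -(card_in_imset inj_edge); apply: matching_number_ge.
apply/andP; split.
  apply/subsetP=> _ /imsetP[x xC ->].
  by apply/edgesP; exists x, (f x); rewrite ef.
apply/trivIsetP => _ _ /imsetP[x xC ->] /imsetP[y yC ->]; apply: contraR.
case/pred0Pn => z /andP[zx zy].
by apply/eqP; congr edge; apply: (meet x y xC yC z).
Qed.

(** Deleting the neighbors of [S] from [I] also removes all of [S] from the neighborhood of [I]. As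
    [I] is critical, the excess cannot grow, so at least [#|S|] vertices are deleted. *)
Lemma critical_hall (I S : {set T}) :
    critical_independent e I -> S \subset neighborhood e I ->
  #|S| <= #|neighborhood e S :&: I|.
Proof.
case/andP=> indI /forall_inP crit sSI.
have indJ : independent e (I :\: neighborhood e S).
  apply/independentP => x y /setDP[xI _] /setDP[yI _].
  exact: (independentP _ indI).
have sNJ :
    neighborhood e (I :\: neighborhood e S) \subset neighborhood e I :\: S.
  apply/subsetP=> y /mem_neighborhood[x /setDP[xI xS] exy].
  rewrite inE; apply/andP; split; last by apply/mem_neighborhood; exists x.
  by apply: contra xS => yS; apply/mem_neighborhood; exists y; rewrite // e_sym.
have := crit _ indJ; rewrite /set_excess.
have := subset_leq_card sNJ; rewrite cardsD (setIidPr sSI).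
have := cardsID (neighborhood e S) I; rewrite [I :&: _]setIC.
by have := subset_leq_card sSI; lia.
Qed.

End Graph.

Theorem theorem3p1 (T : finType) (e : rel T)
    (e_sym : symmetric e) (e_irr : irreflexive e) :
  independence_number e = critical_independence_number e <->
  covering_number e = matching_number e.
Proof.
have alpha_tau := independence_covering_number e; split=> [eq_alpha|eq_tau].
  have [I critI cardI] := critical_independence_numberP e.
  have /andP[indI _] := critI.
  (* The largest critical set is now also a maximum independent set. *)
  rewrite -eq_alpha in cardI.
  have NI := maximum_independent_neighborhood e_sym e_irr indI cardI.
  apply/eqP; rewrite eqn_leq matching_number_le andbT.
  have -> : covering_number e = #|~: I| by have := cardsC I; lia.
  (* A vertex [t0] is needed as the default value in Hall's theorem. *)
  have [->|[t0 _]] := set_0Vmem (~: I); first by rewrite cards0.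
  have [|f [injf fN]] :=
    @hall_injection _ _ t0 (fun x => neighbors e x :&: I) (~: I).
    move=> S; rewrite -NI => /(critical_hall e_sym critI) /leq_trans; apply.
    apply/subset_leq_card/subsetP => y /setIP[/bigcupP[x xS xy] yI].
    by apply/bigcupP; exists x; rewrite // inE xy.
  apply: (matching_of_injection injf) => x /fN /setIP[]; rewrite inE => // _.
  by rewrite inE negbK.
apply/eqP; rewrite eqn_leq critical_independence_number_le andbT.
have [I indI cardI] := independence_numberP e.
have [M matM cardM] := matching_numberP e.
rewrite -cardI; apply: critical_independence_number_ge.
rewrite /critical_independent indI; apply/forall_inP => J _.
(* The excess of [I] is at least [2 * #|I| - #|T|], which equals [#|T| - 2 * #|M|] by [alpha_tau]
   and [eq_tau]; this bounds the excess of [J]. *)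
have := matching_excess_le e_sym e_irr J matM.
have := subset_leq_card (independent_neighborhood_disjoint indI).
by have := cardsC I; rewrite /set_excess; lia.
Qed.
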